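(* For $n\in\mathbb{Z}^{+}$ let $f_n$ be the $n$-fold nested floor function given by $f_1(x)=\lfloor x\rfloor$ and $f_{m+1}(x)=\lfloor x\cdot f_m(x)\rfloor$ for $m\ge 1$, and let $P(f_n)$ be the set of all discontinuity points $x\ge 1$ of $f_n$. Then, for every $n\in\mathbb{Z}^{+}$, $$P(f_1)\subset P(f_2)\subset\dots\subset P(f_n).$$
   Context: For real $x$, $\lfloor x\rfloor$ is the greatest integer less than or equal to $x$. $\mathbb{Z}^{+}$ is the set of positive integers. The functions $f_n$ are regarded as functions on $\mathbb{R}$, and only their discontinuity points $x\ge 1$ are considered (so that both one-sided limits are taken also at $x=1$; in this convention $P(f_1)=\mathbb{Z}^{+}$). The symbol $\subset$ means ''is a subset of''. *)

(* Defs.v *)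
From HB Require Import structures.
From mathcomp Require Import all_boot all_order all_algebra.
From mathcomp Require Import all_classical all_reals all_analysis.
Import Order.TTheory GRing.Theory Num.Theory.
Import numFieldNormedType.Exports.

Set Implicit Arguments.
Unset Strict Implicit.
Unset Printing Implicit Defensive.

Local Open Scope classical_set_scope.
Local Open Scope ring_scope.

(* [nested_floor n] is f_n for n >= 1: [iter] applies the recursion step n - 1
   times to f_1 = floor. The value n = 0 is a junk case, equal to f_1. *)
Definition nested_floor (R : realType) (n : nat) : R -> R :=
  iter n.-1 (fun (f : R -> R) (x : R) => (Num.floor (x * f x))%:~R)
            (fun x : R => (Num.floor x)%:~R).

(* Continuity is that of a function on the whole line, so that at x = 1 the
   values to the left of 1 matter too. *)
Definition discontinuity_points (R : realType) (f : R -> R) : set R :=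
  [set x | 1 <= x /\ ~ {for x, continuous f}].

(* Main.v *)
Require Import Defs.
From HB Require Import structures.
From mathcomp Require Import all_boot all_order all_algebra.
From mathcomp Require Import all_classical all_reals all_analysis.
Import Order.TTheory GRing.Theory Num.Theory.
Import numFieldNormedType.Exports.
Local Open Scope classical_set_scope.
Local Open Scope ring_scope.

(* Each f_m is integer-valued and nondecreasing on [0, +oo[. If f_m jumps by at
   least 1 between y <= z with z >= 1, then x * f_m(x) grows by at least 1
   between them, so f_(m+1) jumps too. An integer-valued function is continuous
   at x exactly when it is constant near x, hence f_m is constant near x >= 1
   whenever f_(m+1) is. *)

Lemma nested_floorSS (R : realType) (m : nat) (x : R) :
  nested_floor m.+2 x = (Num.floor (x * nested_floor m.+1 x))%:~R.
Proof. by []. Qed.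

Lemma nested_floor_intP (R : realType) (m : nat) (x : R) :
  exists k : int, nested_floor m.+1 x = k%:~R.
Proof.
by case: m => [|m]; [exists (Num.floor x) | rewrite nested_floorSS; eexists].
Qed.

Lemma nested_floor_ge0 (R : realType) (m : nat) (x : R) :
  0 <= x -> 0 <= nested_floor m.+1 x.
Proof.
move=> x0; elim: m => [|m IH]; first by rewrite /nested_floor /= ler0z floor_ge0.
by rewrite nested_floorSS ler0z floor_ge0 mulr_ge0.
Qed.

(** For [0 <= x] both factors of [x * f_m(x)] are nonnegative, so the product inherits monotonicity.
    This fails on negative arguments: f_2(-1) = 1 while f_2(0) = 0. *)
Lemma nested_floor_homo (R : realType) (m : nat) (x y : R) :
  0 <= x -> x <= y -> nested_floor m.+1 x <= nested_floor m.+1 y.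
Proof.
move=> x0 xy; elim: m => [|m IH]; first by rewrite /nested_floor /= ler_int le_floor.
by rewrite !nested_floorSS ler_int le_floor// ler_pM// nested_floor_ge0.
Qed.

Lemma nested_floor_eq_pred (R : realType) (m : nat) (y z : R) :
  0 <= y -> y <= z -> 1 <= z ->
  nested_floor m.+2 y = nested_floor m.+2 z ->
  nested_floor m.+1 y = nested_floor m.+1 z.
Proof.
move=> y0 yz z1; rewrite !nested_floorSS => /intr_inj fE.
have fy0 := nested_floor_ge0 R m y y0; have := nested_floor_homo R m y z y0 yz.
rewrite le_eqVlt => /predU1P[//|].
have [[a aE] [b bE]] := (nested_floor_intP R m y, nested_floor_intP R m z).
rewrite aE in fy0 fE *; rewrite bE in fE *.
rewrite ltr_int -lezD1 -(ler_int R) rmorphD/= => ab.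
(* From [a + 1 <= b], [0 <= a] and [1 <= z] one gets [z * b >= z * a + z >= y * a + 1], so the two
   floors cannot agree. *)
suff: Num.floor (y * a%:~R) + 1 <= Num.floor (z * b%:~R).
  by rewrite fE lezD1 ltxx.
rewrite floor_ge_int rmorphD/=.
have z0 : 0 <= z by exact: le_trans z1.
apply: le_trans (ler_wpM2l z0 ab); rewrite mulrDr mulr1 lerD//.
by rewrite (le_trans (floor_le _))// ler_wpM2r.
Qed.

(** Tolerance 1 suffices: two integers at distance less than 1 coincide. *)
Lemma continuous_at_intP (R : realType) (f : R -> R) (x : R) :
  (forall y, exists k : int, f y = k%:~R) ->
  {for x, continuous f} <-> \forall y \near x, f y = f x.
Proof.
move=> fint; split=> [/cvgrPdist_lt /(_ 1 ltr01) | fx]; last first.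
  by apply: cvg_near_cst.
apply: filterS => y.
have [[a ->] [b ->]] := (fint x, fint y).
rewrite -rmorphB/= -intr_norm -[1]/(1%:~R) ltr_int.
by rewrite -[1]add0r ltzD1 normr_le0 subr_eq0 => /eqP->.
Qed.

Theorem theorem5 (R : realType) (n : nat) (hn : (1 <= n)%N) :
  forall m : nat, (1 <= m)%N -> (m < n)%N ->
    discontinuity_points (@nested_floor R m) `<=`
    discontinuity_points (@nested_floor R m.+1).
Proof.
case=> // m _ _ x [x1 fm]; split=> //; apply: contra_not fm.
rewrite !continuous_at_intP; try exact: nested_floor_intP.
have x0 : 0 < x by exact: lt_le_trans x1.
(* Points [y] near [x] are positive but may lie below 1. This is harmless, since
   [nested_floor_eq_pred] asks [1 <= z] only of the larger point, which is at least [x]. *)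
apply: filterS2 (lt_nbhsr x0) => y /ltW y0.
have [yx|/ltW xy] := leP y x; first exact: nested_floor_eq_pred.
move=> /esym fE; apply/esym/nested_floor_eq_pred => //; first exact: ltW.
exact: le_trans xy.
Qed.
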